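(* Let $A\in\mathbb{H}^{m\times n}$ have rank $k$, let $I\subset\{1,\dots,m\}$ and $J\subset\{1,\dots,n\}$ be index sets of cardinality $k$, and assume that $B=A[I,J]\in\mathbb{H}^{k\times k}$ is nonsingular. Then $$A=A[:,J]\,B^{-1}\,A[I,:].$$
   Context: $\mathbb{H}$ is the skew field of real quaternions. $A[I,J]$ is the submatrix of $A$ with rows $I$ and columns $J$; $A[:,J]$ and $A[I,:]$ are the submatrices formed by the columns in $J$ and by the rows in $I$. Nonsingular means having a two-sided inverse over $\mathbb{H}$. The rank of a quaternion matrix is the dimension of the right $\mathbb{H}$-span of its columns (equivalently, the number of nonzero quaternion singular values). *)

(* Defs.v *)
From HB Require Import structures.
From mathcomp Require Import all_boot all_order all_algebra.
From mathcomp Require Import boolp classical_sets reals.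
From mathcomp Require Import ring lra.

Set Implicit Arguments.
Unset Strict Implicit.
Unset Printing Implicit Defensive.

Import Order.TTheory GRing.Theory Num.Theory.
Local Open Scope ring_scope.

(* Quat a b c d stands for a + b i + c j + d k. *)
Record quaternion (R : Type) : Type :=
  Quat { quat0 : R; quat1 : R; quat2 : R; quat3 : R }.

Definition prod_of_quat (R : Type) (x : quaternion R) : R * R * R * R :=
  (quat0 x, quat1 x, quat2 x, quat3 x).

Definition quat_of_prod (R : Type) (u : R * R * R * R) : quaternion R :=
  let: (a, b, c, d) := u in Quat a b c d.

Lemma prod_of_quatK (R : Type) :
  cancel (@prod_of_quat R) (@quat_of_prod R).
Proof. by case. Qed.

HB.instance Definition _ (R : realType) :=
  Choice.copy (quaternion R) (can_type (@prod_of_quatK R)).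

Definition addq (R : realType) (x y : quaternion R) : quaternion R :=
  Quat (quat0 x + quat0 y) (quat1 x + quat1 y)
       (quat2 x + quat2 y) (quat3 x + quat3 y).

Definition oppq (R : realType) (x : quaternion R) : quaternion R :=
  Quat (- quat0 x) (- quat1 x) (- quat2 x) (- quat3 x).

Lemma addqA (R : realType) : associative (@addq R).
Proof. by move=> x y z; congr Quat; apply: addrA. Qed.

Lemma addqC (R : realType) : commutative (@addq R).
Proof. by move=> x y; congr Quat; apply: addrC. Qed.

Lemma add0q (R : realType) : left_id (Quat 0 0 0 0) (@addq R).
Proof. by case=> a b c d; congr Quat; apply: add0r. Qed.

Lemma addNq (R : realType) :
  left_inverse (Quat 0 0 0 0) (@oppq R) (@addq R).
Proof. by case=> a b c d; congr Quat; apply: addNr. Qed.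

HB.instance Definition _ (R : realType) :=
  GRing.isZmodule.Build (quaternion R)
    (@addqA R) (@addqC R) (@add0q R) (@addNq R).

(* Hamilton product: i^2 = j^2 = k^2 = i j k = -1. *)
Definition mulq (R : realType) (x y : quaternion R) : quaternion R :=
  let: Quat a1 b1 c1 d1 := x in
  let: Quat a2 b2 c2 d2 := y in
  Quat (a1 * a2 - b1 * b2 - c1 * c2 - d1 * d2)
       (a1 * b2 + b1 * a2 + c1 * d2 - d1 * c2)
       (a1 * c2 - b1 * d2 + c1 * a2 + d1 * b2)
       (a1 * d2 + b1 * c2 - c1 * b2 + d1 * a2).

Lemma mulqA (R : realType) : associative (@mulq R).
Proof.
by case=> a1 b1 c1 d1 [a2 b2 c2 d2] [a3 b3 c3 d3]; congr Quat => /=; ring.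
Qed.

Lemma mul1q (R : realType) : left_id (Quat 1 0 0 0) (@mulq R).
Proof. by case=> a b c d; congr Quat => /=; ring. Qed.

Lemma mulq1 (R : realType) : right_id (Quat 1 0 0 0) (@mulq R).
Proof. by case=> a b c d; congr Quat => /=; ring. Qed.

Lemma mulqDl (R : realType) : left_distributive (@mulq R) +%R.
Proof.
by case=> a1 b1 c1 d1 [a2 b2 c2 d2] [a3 b3 c3 d3]; congr Quat => /=; ring.
Qed.

Lemma mulqDr (R : realType) : right_distributive (@mulq R) +%R.
Proof.
by case=> a1 b1 c1 d1 [a2 b2 c2 d2] [a3 b3 c3 d3]; congr Quat => /=; ring.
Qed.

Lemma oneq_neq0 (R : realType) : Quat 1 0 0 0 != 0 :> quaternion R.
Proof. by apply/eqP => -[] /eqP; rewrite oner_eq0. Qed.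

HB.instance Definition _ (R : realType) :=
  GRing.Zmodule_isNzRing.Build (quaternion R)
    (@mulqA R) (@mul1q R) (@mulq1 R) (@mulqDl R) (@mulqDr R) (@oneq_neq0 R).

Definition sqrnormq (R : realType) (x : quaternion R) : R :=
  quat0 x ^+ 2 + quat1 x ^+ 2 + quat2 x ^+ 2 + quat3 x ^+ 2.

Definition invq (R : realType) (x : quaternion R) : quaternion R :=
  Quat (quat0 x / sqrnormq x) (- quat1 x / sqrnormq x)
       (- quat2 x / sqrnormq x) (- quat3 x / sqrnormq x).

Lemma sqrnormq_neq0 (R : realType) (x : quaternion R) :
  x != 0 -> sqrnormq x != 0.
Proof.
apply: contraNneq; case: x => a b c d; rewrite /sqrnormq /= => h.
have ha := sqr_ge0 a; have hb := sqr_ge0 b.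
have hc := sqr_ge0 c; have hd := sqr_ge0 d.
have /eqP : a ^+ 2 = 0 by lra.
have /eqP : b ^+ 2 = 0 by lra.
have /eqP : c ^+ 2 = 0 by lra.
have /eqP : d ^+ 2 = 0 by lra.
by rewrite !sqrf_eq0 => /eqP -> /eqP -> /eqP -> /eqP ->.
Qed.

Lemma mulVq (R : realType) :
  {in [pred x : quaternion R | x != 0], left_inverse 1 (@invq R) *%R}.
Proof.
move=> x /sqrnormq_neq0; case: x => a b c d; rewrite /sqrnormq /= => h.
by congr Quat => /=; rewrite /sqrnormq /=; field.
Qed.

Lemma mulqV (R : realType) :
  {in [pred x : quaternion R | x != 0], right_inverse 1 (@invq R) *%R}.
Proof.
move=> x /sqrnormq_neq0; case: x => a b c d; rewrite /sqrnormq /= => h.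
by congr Quat => /=; rewrite /sqrnormq /=; field.
Qed.

Lemma unitqP (R : realType) (x y : quaternion R) :
  y * x = 1 /\ x * y = 1 -> x \in [pred x : quaternion R | x != 0].
Proof.
case=> + _; rewrite inE; apply: contra_eqN => /eqP ->.
by rewrite mulr0 eq_sym oner_eq0.
Qed.

Lemma invq_out (R : realType) :
  {in [predC [pred x : quaternion R | x != 0]], @invq R =1 id}.
Proof.
by move=> x; rewrite !inE negbK => /eqP ->; congr Quat; rewrite /= ?oppr0 mul0r.
Qed.

(* The units are exactly the nonzero quaternions. *)
HB.instance Definition _ (R : realType) :=
  GRing.NzRing_hasMulInverse.Build (quaternion R)
    (@mulVq R) (@mulqV R) (@unitqP R) (@invq_out R).

(* \rank, invmx and the dimension of a subspace are only available over
   commutative rings or fields, hence the definitions below. *)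

(* The entries of A *m v are sums of A i j * v j, so the scalars v j act on the
   columns of A from the right. *)
Definition right_span (H : nzRingType) (m n : nat) (A : 'M[H]_(m, n)) :
  set 'cV[H]_m := range (fun v : 'cV[H]_n => A *m v).

Definition right_free (H : nzRingType) (m n : nat) (A : 'M[H]_(m, n)) : Prop :=
  forall v : 'cV[H]_n, A *m v = 0 -> v = 0.

Definition right_dim (H : nzRingType) (m : nat) (W : set 'cV[H]_m) (k : nat) :
  Prop :=
  exists C : 'M[H]_(m, k), right_free C /\ right_span C = W.

Definition has_rank (H : nzRingType) (m n : nat) (A : 'M[H]_(m, n)) (k : nat) :
  Prop :=
  right_dim (right_span A) k.

Definition is_inverse (H : nzRingType) (k : nat) (B C : 'M[H]_k) : Prop :=
  B *m C = 1%:M /\ C *m B = 1%:M.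

Definition nonsingular (H : nzRingType) (k : nat) (B : 'M[H]_k) : Prop :=
  exists C : 'M[H]_k, is_inverse B C.

(* Like invmx, the inverse of a singular matrix is the matrix itself. *)
Definition inverse (H : nzRingType) (k : nat) (B : 'M[H]_k) : 'M[H]_k :=
  xget B [set C | is_inverse B C].

Lemma inverseP (H : nzRingType) (k : nat) (B : 'M[H]_k) :
  nonsingular B -> is_inverse B (inverse B).
Proof. exact: xgetPex. Qed.

Lemma is_inverse_uniq (H : nzRingType) (k : nat) (B C D : 'M[H]_k) :
  is_inverse B C -> is_inverse B D -> C = D.
Proof.
by move=> [_ CB] [BD _]; rewrite -[C]mulmx1 -BD mulmxA CB mul1mx.
Qed.

(* The increasing enumeration of I, indexed by 'I_k rather than 'I_#|I|, so that
   A[I, J] is a square matrix. *)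
Definition idx (m k : nat) (I : {set 'I_m}) (hI : #|I| = k) (i : 'I_k) : 'I_m :=
  enum_val (cast_ord (esym hI) i).

Definition submat (H : Type) (m n k : nat) (A : 'M[H]_(m, n))
  (I : {set 'I_m}) (J : {set 'I_n}) (hI : #|I| = k) (hJ : #|J| = k) :
  'M[H]_k := mxsub (idx hI) (idx hJ) A.

Definition subcols (H : Type) (m n k : nat) (A : 'M[H]_(m, n))
  (J : {set 'I_n}) (hJ : #|J| = k) : 'M[H]_(m, k) := colsub (idx hJ) A.

Definition subrows (H : Type) (m n k : nat) (A : 'M[H]_(m, n))
  (I : {set 'I_m}) (hI : #|I| = k) : 'M[H]_(k, n) := rowsub (idx hI) A.

(* Main.v *)
(** Write [A = C X] with [C] a basis of the column space. Then
    [B = C[I,:] X[:,J]] is a product of two square matrices, so that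
    [X[:,J] B^-1] is a right inverse of [C[I,:]]. A one-sided inverse of a square
    matrix over a skew field is two-sided, hence [X[:,J] B^-1 C[I,:] = 1], and
    multiplying by [C] and [X] gives the factorization. *)
Require Import Defs.
From mathcomp Require Import all_boot all_order all_algebra.
From mathcomp Require Import reals.

Import GRing.Theory.
Local Open Scope ring_scope.

Definition is_skew_field (H : unitRingType) : Prop :=
  forall x : H, x != 0 -> x \is a GRing.unit.

(** Gaussian elimination, by induction on the number of columns: a pivot in the first column removes
    one unknown and one equation. *)
Lemma right_free_leq {H : unitRingType} {m n : nat} {A : 'M[H]_(m, n)} :
  is_skew_field H -> right_free A -> (n <= m)%N.
Proof.
move=> skewH; elim: n m A => [//|n IHn] m A freeA.
have [i Ai0] : exists i, A i ord0 != 0.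
  apply/existsP; rewrite -[X in is_true X]negbK negb_exists.
  apply/negP => /forallP /= A0.
  have /freeA : A *m delta_mx ord0 ord0 = 0 :> 'cV_m.
    by rewrite -colE; apply/colP => i; rewrite !mxE; apply/eqP/negPn.
  by move/colP/(_ ord0)/eqP; rewrite !mxE !eqxx oner_eq0.
case: m => [|m] in A freeA i Ai0 *; first by case: i {Ai0}.
pose u : 'rV[H]_n := rsubmx (row i A : 'rV_(1 + n)).
have Ai : row i A = row_mx (A i ord0)%:M u.
  rewrite -[LHS](@hsubmxK _ 1 1 n) -/u.
  suff -> : lsubmx (row i A : 'rV_(1 + n)) = (A i ord0)%:M by [].
  apply/matrixP => a b; rewrite !ord1 !mxE eqxx mulr1n.
  by congr (A i _); apply: val_inj.
(* The columns of [K] span the solutions of the [i]-th equation of [A *m w = 0]. *)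
pose K : 'M[H]_(1 + n, n) := col_mx (- ((A i ord0)^-1)%:M *m u) 1%:M.
have AiK : row i (A *m K) = 0.
  rewrite row_mul Ai (@mul_row_col _ 1 1 n) mulmx1 mulmxA mulmxN -scalar_mxM.
  by rewrite mulrV ?skewH // mulNmx mul1mx addNr.
(* Row [i] of [A *m K] is zero, so deleting it keeps the kernel; [K] is injective since its lower
   block is the identity. *)
rewrite ltnS; apply: (IHn _ (row' i (A *m K))) => v Kv0.
have /freeA : A *m (K *m v) = 0.
  rewrite mulmxA; apply/row_matrixP => a; rewrite row_mul row0.
  have [b ->|->] := unliftP i a; last by rewrite AiK mul0mx.
  by rewrite -row_rowsub -row'Esub -row_mul Kv0 row0.
move/(congr1 (@dsubmx _ 1 n 1)).
by rewrite mul_col_mx mul1mx col_mxKd linear0.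
Qed.

Lemma mulmx1_skewC {H : unitRingType} {k : nat} {P Q : 'M[H]_k} :
  is_skew_field H -> P *m Q = 1%:M -> Q *m P = 1%:M.
Proof.
move=> skewH PQ1; apply/eqP; rewrite eq_sym -subr_eq0; apply/negPn/negP => QP.
have [j Dj] : exists j, col j (1%:M - Q *m P) != 0.
  apply/existsP; apply: contraR QP; rewrite negb_exists => /forallP QP0.
  apply/eqP/matrixP => i j; move: (QP0 j); rewrite negbK => /eqP/colP/(_ i).
  by rewrite !mxE.
have PD : P *m col j (1%:M - Q *m P) = 0.
  by rewrite colE mulmxA mulmxBr mulmx1 mulmxA PQ1 mul1mx subrr mul0mx.
(* A nonzero column killed by [P] would extend [Q] to [k + 1] independent
   columns of height [k]. *)
suff /(right_free_leq skewH) : right_free (row_mx Q (col j (1%:M - Q *m P))).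
  by rewrite addn1 ltnn.
move=> w; rewrite -[w]vsubmxK mul_row_col => Qw.
(* Multiplying by [P] kills the added column and turns [Q] into the identity. *)
have u0 : usubmx w = 0.
  have := congr1 (mulmx P) Qw.
  by rewrite mulmxDr !mulmxA PQ1 PD mul0mx mul1mx addr0 mulmx0.
move: Qw; rewrite u0 mulmx0 add0r [dsubmx w]mx11_scalar.
(* A nonzero last coefficient would be invertible, forcing the added column to vanish. *)
have [->|/skewH t_unit] := eqVneq (dsubmx w 0 0) 0.
  by rewrite raddf0 col_mx0.
move/(congr1 (mulmx^~ ((dsubmx w 0 0)^-1)%:M)); rewrite mul0mx -mulmxA.
by rewrite -scalar_mxM mulrV // mulmx1 => D0; rewrite D0 eqxx in Dj.
Qed.

(** Each column of [A] lies in the right span of a basis [C]; its coordinates form a column of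
    [X]. *)
Lemma rank_factorization {H : nzRingType} {m n k : nat} {A : 'M[H]_(m, n)} :
  has_rank A k -> exists (C : 'M[H]_(m, k)) (X : 'M[H]_(k, n)), A = C *m X.
Proof.
move=> [C [_ spanC]].
have /fin_all_exists [x Cx] (j : 'I_n) : exists v : 'cV[H]_k, C *m v = col j A.
  have : right_span A (col j A) by exists (delta_mx j 0); rewrite // -colE.
  by rewrite -spanC => -[v _ <-]; exists v.
exists C, (\matrix_(i, j) x j i 0); apply/matrixP => i j.
move/colP/(_ i): (Cx j); rewrite !mxE => <-.
by apply: eq_bigr => l _; rewrite mxE.
Qed.

(** Immediate, as the unit predicate of [quaternion R] is by definition being nonzero. *)
Lemma quaternion_skew_field (R : realType) : is_skew_field (quaternion R).
Proof. by []. Qed.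

Theorem proposition1 (R : realType) (m n k : nat)
    (A : 'M[quaternion R]_(m, n)) (I : {set 'I_m}) (J : {set 'I_n})
    (hA : has_rank A k) (hI : #|I| = k) (hJ : #|J| = k)
    (hB : nonsingular (submat A hI hJ)) :
  A = subcols A hJ *m inverse (submat A hI hJ) *m subrows A hI.
Proof.
have [BV _] := inverseP hB; have [C [X eA]] := rank_factorization hA.
set V := inverse _ in BV *.
have eB : submat A hI hJ = subrows C hI *m subcols X hJ.
  by rewrite eA; apply: mxsub_mul.
have /(mulmx1_skewC (quaternion_skew_field R)) XVC :
    subrows C hI *m (subcols X hJ *m V) = 1%:M by rewrite mulmxA -eB.
have -> : subcols A hJ = C *m subcols X hJ
  by rewrite eA; exact/esym/mulmx_colsub.
have -> : subrows A hI = subrows C hI *m X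
  by rewrite eA; exact/esym/mul_rowsub_mx.
by rewrite mulmxA -!(mulmxA C) XVC mul1mx.
Qed.
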